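(* The class of $1$-planar graphs does not admit geodesic structure; that is, there is no constant $c$ such that every $1$-planar graph has geodesic treewidth at most $c$.
   Context: All graphs are undirected, without loops and multi-edges. A graph is $1$-planar if it can be drawn in the plane such that each edge is crossed at most once. A geodesic in a graph $G$ is a path in $G$ that is a shortest path between its two endpoints (a single vertex is a geodesic). A partition $\mathcal{P}$ of $G$ is a set of induced subgraphs (parts) whose vertex sets partition $V(G)$; it is a partition into geodesics if the vertices of each part are exactly the vertices of a geodesic of $G$. The quotient $G/\mathcal{P}$ is the simple graph obtained from $G$ by contracting (identifying) each part into a single vertex, removing loops and multi-edges. The geodesic treewidth of $G$ is the smallest $k$ for which there is a partition $\mathcal{P}$ of $G$ into geodesics such that $G/\mathcal{P}$ has treewidth $k$. A graph class admits geodesic structure if there is a constant bounding the geodesic treewidth of all its members. *)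

(* Defs.v *)
From HB Require Import structures.
From mathcomp Require Import all_boot all_order all_algebra.
From mathcomp Require Import all_classical all_reals all_analysis.
Import Order.TTheory GRing.Theory Num.Theory.
Import numFieldNormedType.Exports.

Set Implicit Arguments.
Unset Strict Implicit.
Unset Printing Implicit Defensive.

Local Open Scope classical_set_scope.

Record sgraph := SGraph {
  vertex :> finType;
  adj : rel vertex;
  adj_sym : symmetric adj;
  adj_irr : irreflexive adj
}.

Definition is_edge (G : sgraph) (S : {set G}) : Prop :=
  exists x y : G, adj x y /\ S = [set x; y]%SET.

(* The path visits x :: p in order; its length (number of edges) is size p. *)
Definition is_path (G : sgraph) (x : G) (p : seq G) : Prop :=
  path (@adj G) x p /\ uniq (x :: p).

Definition is_geodesic (G : sgraph) (x : G) (p : seq G) : Prop :=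
  is_path x p /\
  forall q : seq G, is_path x q -> last x q = last x p -> size p <= size q.

(* Parts are induced subgraphs, hence determined by their vertex sets. *)
Definition geodesic_partition (G : sgraph) (P : {set {set G}}) : Prop :=
  finset.partition P [set: G]%SET /\
  forall B : {set G}, B \in P ->
    exists (x : G) (p : seq G), is_geodesic x p /\ B = [set:: x :: p]%SET.

Section Quotient.
Variables (G : sgraph) (P : {set {set G}}).

Definition part : finType := {B : {set G} | B \in P}.

Definition quotient_adj : rel part := fun B C =>
  (B != C) && [exists x in val B, exists y in val C, adj x y].

Lemma quotient_adj_sym : symmetric quotient_adj.
Proof.
suff H B C : quotient_adj B C -> quotient_adj C B.
  by move=> B C; apply/idP/idP; exact: H.
case/andP=> BC /exists_inP[x xB /exists_inP[y yC xy]].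
rewrite /quotient_adj eq_sym BC; apply/exists_inP; exists y => //.
by apply/exists_inP; exists x; rewrite // adj_sym.
Qed.

Lemma quotient_adj_irr : irreflexive quotient_adj.
Proof. by move=> B; rewrite /quotient_adj eqxx. Qed.

Definition quotient_graph : sgraph := SGraph quotient_adj_sym quotient_adj_irr.
End Quotient.

Definition is_tree (F : sgraph) : Prop :=
  [/\ 0 < #|F|,
      forall i j : F, connect (@adj F) i j &
      forall c : seq F, ucycle (@adj F) c -> size c < 3].

Definition tree_decomposition (G F : sgraph) (bag : F -> {set G}) : Prop :=
  [/\ is_tree F,
      forall v : G, exists i : F, v \in bag i,
      forall u v : G, adj u v -> exists i : F, u \in bag i /\ v \in bag i &
      forall (v : G) (i j : F), v \in bag i -> v \in bag j ->
        connect [rel k l | [&& adj k l, v \in bag k & v \in bag l]] i j].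

(* Truncated predecessor: the graph without vertices gets treewidth 0, not -1. *)
Definition width (G F : sgraph) (bag : F -> {set G}) : nat :=
  (\max_(i : F) #|bag i|).-1.

Definition has_decomposition_of_width (G : sgraph) (k : nat) : Prop :=
  exists (F : sgraph) (bag : F -> {set G}),
    tree_decomposition bag /\ width bag = k.

Lemma has_decomposition_exists (G : sgraph) :
  exists k, `[< has_decomposition_of_width G k >].
Proof.
have sy : symmetric (fun _ _ : unit => false) by [].
have ir : irreflexive (fun _ _ : unit => false) by [].
pose F := SGraph sy ir; pose bag (_ : F) := [set: G]%SET.
exists (width bag); apply/asboolP; exists F, bag; split => //; split.
- split; first by rewrite card_unit.
  + by move=> [] [].
  + move=> c /andP[_ /card_uniqP <-].
    by apply: (@leq_ltn_trans #|F|); [exact: max_card | rewrite card_unit].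
- by move=> v; exists tt; rewrite finset.inE.
- by move=> u v _; exists tt; rewrite !finset.inE.
- by move=> v [] [].
Qed.

Definition treewidth (G : sgraph) : nat :=
  ex_minn (has_decomposition_exists G).

Definition has_geodesic_partition_of_treewidth (G : sgraph) (k : nat) : Prop :=
  exists P : {set {set G}},
    geodesic_partition P /\ treewidth (quotient_graph P) = k.

Lemma has_geodesic_partition_exists (G : sgraph) :
  exists k, `[< has_geodesic_partition_of_treewidth G k >].
Proof.
pose P := [set [set x]%SET | x in [set: G]]%SET.
exists (treewidth (quotient_graph P)); apply/asboolP; exists P; split => //.
split.
  apply/and3P; split.
  - apply/eqP/setP=> x; rewrite finset.inE; apply/finset.bigcupP.
    by exists [set x]%SET; rewrite ?finset.inE// imset_f ?finset.inE.
  - apply/finset.trivIsetP=> _ _ /imsetP[x _ ->] /imsetP[y _ ->] xy.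
    rewrite disjoints1 finset.inE; apply: contra_neq xy => ->//.
  - by apply/imsetP=> -[x _ /setP /(_ x)]; rewrite !finset.inE eqxx.
move=> _ /imsetP[x _ ->]; exists x, [::]; split => //.
by apply/setP=> y; rewrite !finset.inE.
Qed.

Definition geodesic_treewidth (G : sgraph) : nat :=
  ex_minn (has_geodesic_partition_exists G).

Definition admits_geodesic_structure (C : sgraph -> Prop) : Prop :=
  exists c : nat, forall G : sgraph, C G -> geodesic_treewidth G <= c.

Section Drawings.
Variable R : realType.
Local Open Scope ring_scope.

Definition inner_points (gamma : R -> R * R) : set (R * R) := gamma @` `]0, 1[.

Record is_drawing (G : sgraph) (pos : G -> R * R)
    (arc : {set G} -> R -> R * R) : Prop := IsDrawing {
  drawing_pos_inj : injective pos;
  drawing_arc_continuous : forall S : {set G}, is_edge S ->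
    {within `[0, 1], continuous (arc S)};
  drawing_arc_inj : forall S : {set G}, is_edge S ->
    set_inj `[0, 1] (arc S);
  drawing_arc_ends : forall S : {set G}, is_edge S ->
    [set arc S 0; arc S 1] = [set pos v | v in [set` S]];
  drawing_arc_avoids : forall (S : {set G}) (v : G), is_edge S ->
    ~ inner_points (arc S) (pos v)
}.

(* A crossing on S is recorded together with the other edge involved, so two
   edges meeting S at the same point count as two crossings of S. Every common
   interior point counts as a crossing, including a tangency. *)
Definition crossings (G : sgraph) (arc : {set G} -> R -> R * R) (S : {set G}) :
    set ({set G} * (R * R)) :=
  [set c | [/\ is_edge c.1, c.1 <> S,
               inner_points (arc S) c.2 & inner_points (arc c.1) c.2]].

Definition one_planar (G : sgraph) : Prop :=
  exists (pos : G -> R * R) (arc : {set G} -> R -> R * R),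
    is_drawing pos arc /\
    forall S : {set G}, is_edge S -> is_subset1 (crossings arc S).
End Drawings.

(* Main.v *)
(* Split every vertex of the (n+1) x (n+1) grid into a row end and a column end
   joined by a path of length 2(n+1). Once split, rows and columns may cross
   without sharing vertices, so the graph is 1-planar. The union of row a,
   column a and the adjacent halves of the long paths is a connected set
   (cross a), and any two crosses meet, at the middle of a long path. By the
   Helly property of subtrees, every tree decomposition of a quotient has a bag
   whose parts together meet all n+1 crosses. But n+1 consecutive vertices of a
   path meet at most two crosses, as passing from one cross to another takes
   half a long path, and a geodesic has fewer than 8(n+1) vertices because of
   the diameter. So each part meets at most 16 crosses and the bag has at least
   (n+1)/16 parts. *)
Require Import Defs.
From mathcomp Require Import reals.
From mathcomp Require Import all_boot all_order all_algebra zify lra.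
From mathcomp Require Import all_classical all_reals all_analysis.
Import Order.TTheory GRing.Theory Num.Theory.
Import numFieldNormedType.Exports.

Set Implicit Arguments.
Unset Strict Implicit.
Unset Printing Implicit Defensive.

(** * Walks of bounded length *)

Definition joined (T : Type) (e : rel T) (k : nat) (x y : T) : Prop :=
  exists p, [/\ path e x p, last x p = y & size p <= k].

Lemma joined_trans (T : Type) (e : rel T) (k l : nat) (x y z : T) :
  joined e k x y -> joined e l y z -> joined e (k + l) x z.
Proof.
move=> [p [xp <- pk]] [q [yq <- ql]]; exists (p ++ q).
by rewrite cat_path xp last_cat size_cat leq_add.
Qed.

Lemma joined_sym (T : Type) (e : rel T) (k : nat) (x y : T) :
  symmetric e -> joined e k x y -> joined e k y x.
Proof.
move=> e_sym [p [xp <- pk]]; exists (rev (belast x p)); split.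
- by rewrite rev_path; apply: sub_path xp => u v; rewrite e_sym.
- by case: p {xp pk} => // u p; rewrite /= rev_cons last_rcons.
- by rewrite size_rev size_belast.
Qed.

Lemma joined_leq (T : Type) (e : rel T) (k l : nat) (x y : T) :
  k <= l -> joined e k x y -> joined e l x y.
Proof. by move=> kl [p [? ? /leq_trans]]; exists p; split; auto. Qed.

Lemma joined_connect (T : finType) (e : rel T) (k : nat) (x y : T) :
  joined e k x y -> connect e x y.
Proof. by move=> [p [xp <- _]]; apply/connectP; exists p. Qed.

Lemma joined_chain (T : Type) (e : rel T) (g : nat -> T) (a b : nat) :
  symmetric e ->
  (forall k, minn a b <= k < maxn a b -> e (g k) (g k.+1)) ->
  joined e (maxn a b - minn a b) (g a) (g b).
Proof.
move=> e_sym.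
wlog ab : a b / a <= b => [wl eg|].
  have /orP[ab|ba] := leq_total a b; first exact: wl.
  apply: joined_sym => //; rewrite maxnC minnC; apply: wl => // k.
  by rewrite minnC maxnC; apply: eg.
rewrite (minn_idPl ab) (maxn_idPr ab) => eg; exists (map g (iota a.+1 (b - a))).
rewrite size_map size_iota leqnn; move: (subnKC ab) eg.
move: (b - a) => m; elim: m a {ab} => [|m IHm] a; first by rewrite addn0 => ->.
move=> abm eg; have [||path_m last_m _] := IHm a.+1; first by lia.
  by move=> k /andP[ak kb]; rewrite eg // kb andbT ltnW.
by split=> //=; rewrite eg ?path_m //; lia.
Qed.

(** * The Helly property of subtrees *)

(** Iterating [f] ends in an orbit that is a cycle of [F]. Acyclicity forces its length below 3 and
    irreflexivity of [adj] excludes length 1. *)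
Lemma iter_involutive_point (F : sgraph) (f : F -> F) :
  is_tree F -> (forall i, adj i (f i)) -> exists i, f (f i) = i.
Proof.
move=> [/card_gt0P[x _] _ acyclic] adj_f.
have /trajectP[k k_lt eq_k] := looping_order f x.
have cyc : exists m, iter m.+1 f (iter k f x) = iter k f x.
  exists (order f x - k).-1.
  by rewrite prednK ?subn_gt0 // -iterD subnK // ltnW.
set y := iter k f x in cyc.
have fc : fcycle f (orbit f y) by apply/(orbitPcycle 0 3).
have ac : ucycle (@adj F) (orbit f y).
  by rewrite /ucycle orbit_uniq andbT; apply: sub_cycle fc => i j /eqP <-.
exists y; move: (acyclic _ ac) fc; rewrite /orbit size_traject.
have := order_gt0 f y; case: (order f y) => [|[|[|]]] //= _ _.
  by rewrite andbT => /eqP fy; have := adj_f y; rewrite fy adj_irr.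
by rewrite andbT => /andP[_ /eqP].
Qed.

(* If no node lies in all the subtrees, send each node i to its neighbour in
   the direction of a subtree missing i. In a tree some edge is then
   traversed both ways, and it separates two of the subtrees. *)
Lemma tree_helly (F : sgraph) (I : Type) (T : I -> {set F}) :
  is_tree F ->
  (forall a i j, i \in T a -> j \in T a ->
    connect [rel k l | [&& adj k l, k \in T a & l \in T a]] i j) ->
  (forall a b, exists i, i \in T a /\ i \in T b) ->
  exists i, forall a, i \in T a.
Proof.
move=> tF conn meet; apply: contrapT => noT.
(* [away i] is adjacency in [F] with [i] deleted; [f i] is the first step from [i] towards a subtree
   [T a] missing [i]. *)
pose away i := [rel k l : F | [&& adj k l, k != i & l != i]].
have [|f fP] := @choice F F (fun i j => adj i j /\ exists a, i \notin T a /\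
    forall y, y \in T a -> connect (away i) j y).
  move=> i; have /existsNP[a /negP iNa] : ~ forall a, i \in T a.
    by move=> iT; apply: noT; exists i.
  have [y [ya _]] := meet a a; have [_ /(_ i y) + _] := tF.
  move=> /connectP[q /shortenP[[|j p]] /=].
    by move=> _ _ _ yi; rewrite -yi ya in iNa.
  move=> /andP[ij jp] /andP[ip _] _ y_last; move: ya; rewrite {}y_last => ya.
  exists j; split=> //; exists a; split=> // z za.
  apply: (@connect_trans _ _ (last j p)).
    apply/connectP; exists p => //.
    elim: p j {ij ya} jp ip => //= k p IHp j /andP[jk kp].
    rewrite in_cons negb_or => /andP[ij ikp].
    rewrite jk eq_sym ij IHp // andbT /=.
    by move: ikp; rewrite in_cons negb_or eq_sym => /andP[].
  apply: connect_sub (conn _ _ _ ya za) => k l /and3P[kl ka la].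
  apply: connect1; rewrite /= kl /=.
  by apply/andP; split; apply: contraNneq iNa => <-.
have [i ffi] := iter_involutive_point tF (fun i => (fP i).1).
have [adj_ij [a [_ conn_j]]] := fP i.
have [_ [b [_]]] := fP (f i); rewrite ffi; set j := f i in adj_ij conn_j *.
move=> conn_i; have [y [ya yb]] := meet a b.
(* [cut] deletes the edge between [i] and [j]. The common node [y] is reached from [j] avoiding [i]
   and from [i] avoiding [j], so [i] and [j] stay connected and restoring the edge closes a
   cycle. *)
pose cut := [rel k l : F | adj k l &&
  ~~ ((k == i) && (l == j) || (k == j) && (l == i))].
have cut_sym : symmetric cut by move=> k l; 
  rewrite /= adj_sym orbC !(andbC (_ == j)).
have ji : connect cut j i.
  apply: (@connect_trans _ _ y).
    apply: connect_sub (conn_j y ya) => k l /and3P[kl /negPf ki /negPf li].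
    by apply: connect1; rewrite /= kl ki li andbF.
  rewrite (sym_connect_sym cut_sym).
  apply: connect_sub (conn_i y yb) => k l /and3P[kl /negPf kj /negPf lj].
  by apply: connect1; rewrite /= kl kj lj andbF.
have ij : (i == j) = false by apply: contraTF adj_ij => /eqP <-;
  rewrite adj_irr.
have [_ _ acyclic] := tF.
case/connectP: ji => q /shortenP[p jp Up _ ip].
have := acyclic (j :: p).
rewrite /ucycle Up andbT /= rcons_path -ip adj_ij andbT.
rewrite (sub_path _ jp); last by move=> k l /andP[].
case: p jp ip {Up} => [|k [|l p]] /=.
- by move=> _ ij'; rewrite ij' eqxx in ij.
- by move=> + ik; rewrite -ik !eqxx orbT !andbF.
- by move=> _ _ /(_ isT).
Qed.

(** * A bag meeting every member of a family of connected sets *)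

(** Helly is applied to the sets [T a] of nodes whose bag contains a part meeting [X a]. Two of them
    intersect because [X a] and [X b] share a vertex, whose part lies in some bag. *)
Lemma bag_meets_all (G F : sgraph) (P : {set {set G}})
    (bag : F -> {set quotient_graph P}) (I : Type) (X : I -> {set G}) :
  finset.partition P [set: G]%SET -> tree_decomposition bag ->
  (forall a x y, x \in X a -> y \in X a ->
    connect [rel u v | [&& adj u v, u \in X a & v \in X a]] x y) ->
  (forall a b, exists x, x \in X a /\ x \in X b) ->
  exists i, forall a,
    exists2 B, B \in bag i & exists2 x, x \in val B & x \in X a.
Proof.
move=> /and3P[/eqP cover_P /finset.trivIsetP triv_P _].
move=> [tF cover_bag edge_bag conn_bag].
move=> conn_X meet_X.
have part_of x : exists B : part P, x \in val B.
  have : x \in finset.cover P by rewrite cover_P finset.inE.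
  by move=> /finset.bigcupP[B PB xB]; exists (exist _ B PB).
have part_uniq x (B C : part P) : x \in val B -> x \in val C -> B = C.
  move=> xB xC; apply: contrapT => /eqP BC.
  have /disjointFr/(_ xB) := triv_P _ _ (valP B) (valP C) BC.
  by rewrite xC.
pose T a := [set i | [exists B in bag i, [exists x in val B, x \in X a]]]%SET.
have TP a i (B : part P) x :
    B \in bag i -> x \in val B -> x \in X a -> i \in T a.
  move=> Bi xB xa; rewrite finset.inE; apply/exists_inP; exists B => //.
  by apply/exists_inP; exists x.
have same_part a (B : part P) x i j : x \in val B -> x \in X a ->
    B \in bag i -> B \in bag j ->
    connect [rel k l | [&& adj k l, k \in T a & l \in T a]] i j.
  move=> xB xa Bi Bj; apply: connect_sub (conn_bag B i j Bi Bj) => k l.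
  move=> /and3P[kl Bk Bl]; apply: connect1.
  by rewrite /= kl (TP a k B x) // (TP a l B x).
have [||i iT] := tree_helly (T := T) tF; last first.
- exists i => a; have := iT a; rewrite finset.inE.
  by move=> /exists_inP[B Bi /exists_inP[x xB xa]]; exists B => //; exists x.
- move=> a b; have [x [xa xb]] := meet_X a b; have [B xB] := part_of x.
  by have [i Bi] := cover_bag B; exists i; split; apply: TP xB _.
move=> a i j; rewrite !finset.inE => /exists_inP[B Bi /exists_inP[x xB xa]].
move=> /exists_inP[C Cj /exists_inP[y yC ya]].
(* A walk inside [X a] is followed: when it changes part, the quotient edge puts both parts in a
   common bag [k], and the subtree of the old part leads from [i] to [k]. *)
have /connectP[p xp y_last] := conn_X a x y xa ya.
elim: p x B i xB xa Bi xp y_last => [|x' p IHp] x B i xB xa Bi /=.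
  move=> _ yx; rewrite yx in yC; rewrite -(part_uniq _ _ _ xB yC) in Cj.
  exact: same_part xB xa Bi Cj.
move=> /andP[/and3P[xx' _ x'a] x'p] y_last.
have [B' x'B'] := part_of x'; have [BB'|neqBB'] := eqVneq B B'.
  by apply: (IHp x' B') => //; rewrite -BB'.
have [|k [Bk B'k]] := edge_bag B B'.
  rewrite /= /quotient_adj neqBB'; apply/exists_inP; exists x => //.
  by apply/exists_inP; exists x'.
apply: connect_trans (same_part a B x i k xB xa Bi Bk) _.
exact: (IHp x' B').
Qed.

(** * The split grid and its crosses *)

Section SplitGrid.
Variable n : nat.

Definition split_grid_vertex : finType :=
  ('I_n.+1 * 'I_n.+1 * 'I_(2 * n.+1).+1)%type.

Implicit Types (u v x y : split_grid_vertex) (p : seq split_grid_vertex).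

Definition grow v : nat := v.1.1.
Definition gcol v : nat := v.1.2.
Definition height v : nat := v.2.

(** Steps are oriented: every edge is a step in exactly one direction, which later directs its
    arc. *)
Definition path_step u v : bool :=
  [&& grow u == grow v, gcol u == gcol v & height v == (height u).+1].

Definition row_step u v : bool :=
  [&& grow u == grow v, gcol v == (gcol u).+1, height u == 0 & height v == 0].

Definition col_step u v : bool :=
  [&& gcol u == gcol v, grow v == (grow u).+1,
      height u == 2 * n.+1 & height v == 2 * n.+1].

Definition split_grid_step u v : bool :=
  [|| path_step u v, row_step u v | col_step u v].

Definition split_grid_adj : rel split_grid_vertex :=
  fun u v => split_grid_step u v || split_grid_step v u.

Lemma split_grid_adj_sym : symmetric split_grid_adj.
Proof. by move=> u v; rewrite /split_grid_adj orbC. Qed.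

Lemma split_grid_adj_irr : irreflexive split_grid_adj.
Proof.
by move=> u; rewrite /split_grid_adj /split_grid_step /path_step /row_step
  /col_step; lia.
Qed.

(* The vertex (i, j, t) is the t-th vertex of the long path that replaces the
   grid vertex (i, j); rows run through t = 0, columns through t = 2(n+1). *)
Definition split_grid : sgraph := SGraph split_grid_adj_sym split_grid_adj_irr.

(* Two crosses share only the midpoints of long paths: this keeps short paths
   from meeting three of them. *)
Definition cross (a : 'I_n.+1) : {set split_grid} :=
  [set v | (grow v == a) && (height v <= n.+1)
        || (gcol v == a) && (n.+1 <= height v)]%SET.

Definition grid_point (i j t : nat) : split_grid := (inord i, inord j, inord t).

Lemma grid_pointE v : grid_point (grow v) (gcol v) (height v) = v.
Proof. by case: v => [[i j] t]; rewrite /grid_point !inord_val. Qed.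

Lemma grow_point i j t : i <= n -> grow (grid_point i j t) = i.
Proof. by move=> ?; rewrite /grow /= inordK. Qed.

Lemma gcol_point i j t : j <= n -> gcol (grid_point i j t) = j.
Proof. by move=> ?; rewrite /gcol /= inordK. Qed.

Lemma height_point i j t : t <= 2 * n.+1 -> height (grid_point i j t) = t.
Proof. by move=> ?; rewrite /height /= inordK. Qed.

Lemma grow_le v : grow v <= n. Proof. by rewrite -ltnS ltn_ord. Qed.
Lemma gcol_le v : gcol v <= n. Proof. by rewrite -ltnS ltn_ord. Qed.
Lemma height_le v : height v <= 2 * n.+1. Proof. by rewrite -ltnS ltn_ord. Qed.

Definition adj_within (X : {set split_grid}) : rel split_grid :=
  [rel u v | [&& adj u v, u \in X & v \in X]].

Lemma adj_within_sym X : symmetric (adj_within X).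
Proof. by move=> u v; congr andb; [exact: split_grid_adj_sym|exact: andbC]. Qed.

Lemma joined_height (X : {set split_grid}) i j t t' : i <= n -> j <= n ->
  t <= 2 * n.+1 -> t' <= 2 * n.+1 ->
  (forall k, minn t t' <= k <= maxn t t' -> grid_point i j k \in X) ->
  joined (adj_within X) (maxn t t' - minn t t')
    (grid_point i j t) (grid_point i j t').
Proof.
move=> i_n j_n tM t'M inX; apply: joined_chain; first exact: adj_within_sym.
move=> k kP; apply/and3P; split; [|apply: inX; lia|apply: inX; lia].
rewrite /= /split_grid_adj /split_grid_step /path_step /row_step
  /col_step !grow_point // !gcol_point //.
by rewrite !height_point; lia.
Qed.

Lemma joined_row (X : {set split_grid}) i j j' : i <= n -> j <= n -> j' <= n ->
  (forall k, minn j j' <= k <= maxn j j' -> grid_point i k 0 \in X) ->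
  joined (adj_within X) (maxn j j' - minn j j')
    (grid_point i j 0) (grid_point i j' 0).
Proof.
move=> i_n jn j'n inX; apply: (joined_chain (g := fun k => grid_point i k 0)).
  exact: adj_within_sym.
move=> k kP; apply/and3P; split; [|apply: inX; lia|apply: inX; lia].
rewrite /= /split_grid_adj /split_grid_step /path_step /row_step
  /col_step !grow_point // !height_point //.
by rewrite !gcol_point; lia.
Qed.

Lemma joined_col (X : {set split_grid}) i i' j : i <= n -> i' <= n -> j <= n ->
  (forall k, minn i i' <= k <= maxn i i' -> grid_point k j (2 * n.+1) \in X) ->
  joined (adj_within X) (maxn i i' - minn i i')
    (grid_point i j (2 * n.+1)) (grid_point i' j (2 * n.+1)).
Proof.
move=> i_n i'n jn inX.
apply: (joined_chain (g := fun k => grid_point k j (2 * n.+1))).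
  exact: adj_within_sym.
move=> k kP; apply/and3P; split; [|apply: inX; lia|apply: inX; lia].
rewrite /= /split_grid_adj /split_grid_step /path_step /row_step
  /col_step !gcol_point // !height_point //.
by rewrite !grow_point; lia.
Qed.

(** The walk goes to the row end below [u], along its row, up a long path, along the column of [v]
    and then to [v]: three stretches of at most 2(n+1) edges and two of at most n. *)
Lemma split_grid_diameter u v : joined split_grid_adj (8 * n.+1 - 2) u v.
Proof.
suff [p [up last_p size_p]] :
    joined (adj_within [set: split_grid]) (8 * n.+1 - 2) u v.
  by exists p; split=> //; apply: sub_path up => x y /and3P[].
rewrite -(grid_pointE u) -(grid_pointE v).
have [[ru cu] hu] := (grow_le u, gcol_le u, height_le u).
have [[rv cv] hv] := (grow_le v, gcol_le v, height_le v).
have inT i j t : grid_point i j t \in [set: split_grid]%SET.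
  by rewrite finset.inE.
have dist k l m : k <= m -> l <= m -> maxn k l - minn k l <= m by lia.
have j1 := joined_height (X := [set: split_grid]%SET) ru cu hu (leq0n _)
  (fun k _ => inT _ _ k).
have j2 := joined_row (X := [set: split_grid]%SET) ru cu cv
  (fun k _ => inT _ k _).
have j3 := joined_height (X := [set: split_grid]%SET) ru cv (leq0n _) (leqnn _)
  (fun k _ => inT _ _ k).
have j4 := joined_col (X := [set: split_grid]%SET) ru rv cv
  (fun k _ => inT k _ _).
have j5 := joined_height (X := [set: split_grid]%SET) rv cv (leqnn _) hv
  (fun k _ => inT _ _ k).
have := joined_trans (joined_trans (joined_trans (joined_trans
  (joined_leq (dist _ _ _ hu (leq0n _)) j1) (joined_leq (dist _ _ _ cu cv) j2))
  (joined_leq (dist _ _ _ (leq0n _) (leqnn _)) j3))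
  (joined_leq (dist _ _ _ ru rv) j4)) (joined_leq (dist _ _ _ (leqnn _) hv) j5).
by apply: joined_leq; clear; lia.
Qed.

Lemma cross_point a i j t : i <= n -> j <= n -> t <= 2 * n.+1 ->
  (grid_point i j t \in cross a) =
  ((i == a) && (t <= n.+1) || (j == a) && (n.+1 <= t)).
Proof.
by move=> ? ? ?; rewrite finset.inE grow_point // gcol_point // height_point.
Qed.

(** The long path of (a, a) lies entirely in [cross a] and links its row half to its column half. *)
Lemma cross_connected a x y : x \in cross a -> y \in cross a ->
  connect (adj_within (cross a)) x y.
Proof.
have an : a <= n by rewrite -ltnS.
suff to_center v : v \in cross a ->
    connect (adj_within (cross a)) v (grid_point a a 0).
  move=> xa ya; apply: connect_trans (to_center _ xa) _.
  by rewrite (sym_connect_sym (@adj_within_sym _)) to_center.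
rewrite -(grid_pointE v).
have [[rv cv] hv] := (grow_le v, gcol_le v, height_le v).
rewrite cross_point // => /orP[|] /andP[/eqP-> vh].
  apply: (@connect_trans _ _ (grid_point a (gcol v) 0)).
    by apply: joined_connect; apply: joined_height => // k kP;
    rewrite cross_point; lia.
  by apply: joined_connect; apply: joined_row => // k kP;
    rewrite cross_point; lia.
apply: (@connect_trans _ _ (grid_point (grow v) a (2 * n.+1))).
  by apply: joined_connect; apply: joined_height => // k kP;
    rewrite cross_point; lia.
apply: (@connect_trans _ _ (grid_point a a (2 * n.+1))).
  by apply: joined_connect; apply: joined_col => // k kP;
    rewrite cross_point; lia.
by apply: joined_connect; apply: joined_height => // k kP;
    rewrite cross_point; lia.
Qed.

Lemma cross_meet a b : exists x, x \in cross a /\ x \in cross b.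
Proof.
have [an bn] : a <= n /\ b <= n by split; rewrite -ltnS.
(* Height n+1 belongs to both halves of a long path. *)
by exists (grid_point a b n.+1); rewrite !cross_point; lia.
Qed.

(** * Paths meet few crosses *)

(** The row changes only at height 2(n+1), and the walk is too short to climb there. *)
Lemma path_grow x p : path split_grid_adj x p ->
  height x + size p < 2 * n.+1 -> forall v, v \in x :: p -> grow v = grow x.
Proof.
elim: p x => [|y p IHp] x /=; first by move=> _ _ v; rewrite inE => /eqP->.
move=> /andP[xy yp] short v; rewrite inE => /predU1P[-> //|vp].
have [yx rowE] : height y <= (height x).+1 /\ grow y = grow x.
  by move: xy; rewrite /split_grid_adj /split_grid_step /path_step /row_step
  /col_step; lia.
by rewrite -rowE; apply: IHp vp => //=; lia.
Qed.

Lemma path_gcol x p : path split_grid_adj x p ->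
  size p < height x -> forall v, v \in x :: p -> gcol v = gcol x.
Proof.
elim: p x => [|y p IHp] x /=; first by move=> _ _ v; rewrite inE => /eqP->.
move=> /andP[xy yp] short v; rewrite inE => /predU1P[-> //|vp].
have [yx colE] : height x <= (height y).+1 /\ gcol y = gcol x.
  by move: xy; rewrite /split_grid_adj /split_grid_step /path_step /row_step
  /col_step; lia.
by rewrite -colE; apply: IHp vp => //=; lia.
Qed.

(** From its first vertex of height at most n+1 onwards, the walk has too few steps left to change
    row; earlier vertices are too high to count. *)
Lemma short_path_grow x p : path split_grid_adj x p -> size p < n.+1 ->
  exists i, forall v, v \in x :: p -> height v <= n.+1 -> grow v = i.
Proof.
elim: p x => [|y p IHp] x xp short.
  by exists (grow x) => v; rewrite inE => /eqP->.
have [low|high] := leqP (height x) n.+1.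
  by exists (grow x) => v vp _; apply: (path_grow xp) vp; lia.
move: xp => /andP[_ /IHp[|i iP]]; first exact: ltnW.
by exists i => v; rewrite inE => /predU1P[->|/iP //]; lia.
Qed.

Lemma short_path_gcol x p : path split_grid_adj x p -> size p < n.+1 ->
  exists j, forall v, v \in x :: p -> n.+1 <= height v -> gcol v = j.
Proof.
elim: p x => [|y p IHp] x xp short.
  by exists (gcol x) => v; rewrite inE => /eqP->.
have [high|low] := leqP n.+1 (height x).
  by exists (gcol x) => v vp _; apply: (path_gcol xp) vp; lia.
move: xp => /andP[_ /IHp[|i iP]]; first exact: ltnW.
by exists i => v; rewrite inE => /predU1P[->|/iP //]; lia.
Qed.

(** A low vertex of a cross determines it by its row, a high one by its column, so each half leaves
    one candidate. *)
Lemma short_path_crosses x p : path split_grid_adj x p -> size p < n.+1 ->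
  exists s : seq 'I_n.+1, size s <= 2 /\
    forall v a, v \in x :: p -> v \in cross a -> a \in s.
Proof.
move=> xp short; have [i iP] := short_path_grow xp short.
have [j jP] := short_path_gcol xp short.
exists [:: inord i; inord j]; split=> // v a vp.
rewrite !inE => /orP[] /andP[/eqP va vh].
  by rewrite -(iP v vp vh) va inord_val eqxx.
by rewrite -(jP v vp vh) va inord_val eqxx orbT.
Qed.

Lemma path_crosses k x p : path split_grid_adj x p -> size p < k * n.+1 ->
  exists s : seq 'I_n.+1, size s <= 2 * k /\
    forall v a, v \in x :: p -> v \in cross a -> a \in s.
Proof.
elim: k x p => [|k IHk] x p; first by rewrite mul0n.
(* [x] and the first [n] entries of [p] make a block of at most n+1 vertices; the edge to the next
   block is dropped. *)
rewrite -{1 3}(cat_take_drop n p) cat_path => /andP[xp xp'] short.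
have [|s [s2 sP]] := short_path_crosses xp.
  by rewrite size_take_min ltnS geq_minl.
have := size_drop n p; case: (drop n p) xp' => [|y p'] /=.
  by move=> _ _; exists s; split; [lia|rewrite cats0].
move=> /andP[_ yp'] size_p'; have [|s' [s'2 s'P]] := IHk _ _ yp'.
  by move: short => /=; lia.
exists (s ++ s'); split; first by rewrite size_cat; lia.
move=> v a; rewrite -cat_cons mem_cat => /orP[vp|vp'] va.
  by rewrite mem_cat (sP v a vp va).
by rewrite mem_cat (s'P v a vp' va) orbT.
Qed.

Lemma geodesic_crosses (x : split_grid) (p : seq split_grid) :
  is_geodesic x p ->
  exists s : seq 'I_n.+1, size s <= 16 /\
    forall (v : split_grid) a, v \in x :: p -> v \in cross a -> a \in s.
Proof.
move=> [[xp _] shortest]; apply: (path_crosses (k := 8)) xp _.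
have [q [xq last_q size_q]] := split_grid_diameter x (last x p).
suff size_p : size p <= size q.
  by apply: leq_ltn_trans size_p (leq_ltn_trans size_q _); lia.
(* Geodesics are compared with simple paths only, so the walk [q] is first shortened to [r]. *)
case/shortenP: xq last_q => r xr Ur rq last_r.
apply: leq_trans (shortest r (conj xr Ur) last_r) _.
by apply: uniq_leq_size rq; case/andP: Ur.
Qed.

End SplitGrid.

(** * The lower bound on geodesic treewidth *)

Lemma size_flatten_le (T U : Type) (s : T -> seq U) (m : nat) (r : seq T) :
  (forall x, size (s x) <= m) ->
  size (flatten [seq s x | x <- r]) <= m * size r.
Proof.
by move=> sm; elim: r => //= x r IHr; rewrite size_cat mulnS leq_add.
Qed.

Lemma geodesic_treewidth_split_grid n c :
  geodesic_treewidth (split_grid n) <= c -> n.+1 <= 16 * c.+1.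
Proof.
rewrite /geodesic_treewidth.
case: ex_minnP => k /asboolP[P [[partP geoP] twP]] _ kc.
move: twP; rewrite /treewidth.
case: ex_minnP => l /asboolP[F [bag [decF widthF]]] _ lk.
have [i iP] := bag_meets_all partP decF (@cross_connected n) (@cross_meet n).
have bag_le : #|bag i| <= c.+1.
  have : #|bag i| <= \max_(i : F) #|bag i| by apply: leq_bigmax.
  by move: widthF; rewrite /width; lia.
have [|s sP] := @choice (part P) (seq 'I_n.+1) (fun B s => size s <= 16 /\
    forall v a, v \in val B -> v \in cross a -> a \in s).
  move=> B; have [x [p [xp ->]]] := geoP _ (valP B).
  have [s [s16 sP]] := geodesic_crosses xp; exists s; split=> // v a.
  by rewrite finset.inE => vp va; exact: sP vp va.
(* All n+1 indices occur in [r], which has at most 16 entries per part of the bag. *)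
pose r := flatten [seq s B | B <- enum (bag i)].
have size_r : size r <= 16 * c.+1.
  apply: (@leq_trans (16 * #|bag i|)); last by rewrite leq_mul2l.
  by rewrite cardE; apply: size_flatten_le => B; case: (sP B).
rewrite -(size_enum_ord n.+1); apply: leq_trans size_r.
apply: uniq_leq_size (enum_uniq _) _ => a _.
have [B Bi [x xB xa]] := iP a; apply/flattenP; exists (s B).
  by rewrite map_f // mem_enum.
by have [_ /(_ x a xB xa)] := sP B.
Qed.

(** * A drawing with at most one crossing per edge *)

Section Drawing.
Variables (R : realType) (n : nat).
Local Open Scope ring_scope.

Implicit Types (u v : split_grid n) (P : R * R) (S : {set split_grid n}).

(* The long path of (i, j) is drawn as a diagonal segment from its row end to
   its column end, off every crossing of a row with a column. *)
Definition abscissa v : nat := (4 * (n.+1 * gcol v) + 2 * n.+1 - height v)%N.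
Definition ordinate v : nat := (4 * (n.+1 * grow v) + height v)%N.

(** Grid vertex (i, j) occupies a square of side 2(n+1), with corners spaced 4(n+1). Rows run along
    bottom sides and columns along left sides, so they meet at lower left corners, off the
    diagonals. *)
Definition grid_pos v : R * R := ((abscissa v)%:R, (ordinate v)%:R).

Definition segment (p q : R * R) (s : R) : R * R :=
  (p.1 + s * (q.1 - p.1), p.2 + s * (q.2 - p.2)).

(** Arcs are indexed by unordered edges, so the step relation chooses a direction. The constant map
    is a default for sets that are not edges. *)
Definition grid_arc S : R -> R * R :=
  if [pick e : split_grid n * split_grid n |
      split_grid_step e.1 e.2 && (S == [set e.1; e.2]%SET)] is Some e
  then segment (grid_pos e.1) (grid_pos e.2) else fun=> (0, 0).

Lemma grid_arcP S : is_edge S -> exists u v,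
  [/\ split_grid_step u v, S = [set u; v]%SET &
      grid_arc S = segment (grid_pos u) (grid_pos v)].
Proof.
move=> [x [y [xy Sxy]]]; rewrite /grid_arc.
case: pickP => [e /andP[e12 /eqP Se]|none].
  by exists e.1, e.2.
have /orP[step|step] := xy.
  by have := none (x, y); rewrite /= step Sxy eqxx.
by have := none (y, x); rewrite /= step Sxy finset.setUC eqxx.
Qed.

(** Products such as [n.+1 * grow u] are opaque to [lia]; the gap between distinct multiples
    supplies the linear facts it needs. *)
Lemma mul_trichotomy (m a b : nat) :
  [\/ a = b, (m * a + m <= m * b)%N | (m * b + m <= m * a)%N].
Proof.
rewrite -!mulnSr; case: (ltngtP a b) => [ab|ba|->]; last exact: Or31.
  by apply: Or32; rewrite leq_mul2l ab orbT.
by apply: Or33; rewrite leq_mul2l ba orbT.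
Qed.

Lemma vertex_eq u v :
  grow u = grow v -> gcol u = gcol v -> height u = height v -> u = v.
Proof.
by move=> r c h; rewrite -(grid_pointE u) -(grid_pointE v) r c h.
Qed.

(** Within a square each coordinate varies by at most half the spacing, so equal ordinates force
    equal rows and equal abscissas equal columns. *)
Lemma grid_pos_nat_inj u v :
  abscissa u = abscissa v -> ordinate u = ordinate v -> u = v.
Proof.
have [uh vh] := (height_le u, height_le v).
rewrite /abscissa /ordinate => xx yy.
have [rr||] := mul_trichotomy n.+1 (grow u) (grow v); try lia.
have [cc||] := mul_trichotomy n.+1 (gcol u) (gcol v); try lia.
by apply: vertex_eq; rewrite ?rr // in yy *; lia.
Qed.

Lemma grid_pos_inj : injective grid_pos.
Proof.
move=> u v [] /eqP + /eqP; rewrite !eqr_nat => /eqP xx /eqP yy.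
exact: grid_pos_nat_inj.
Qed.

Lemma step_irr u : ~~ split_grid_step u u.
Proof. by rewrite /split_grid_step /path_step /row_step /col_step; lia. Qed.

Lemma segment_inj (p q : R * R) : p <> q -> injective (segment p q).
Proof.
move=> pq s t [/addrI xx /addrI yy]; apply: contrapT => st; apply: pq.
have st0 : s - t != 0 by rewrite subr_eq0; apply/eqP.
have : (s - t) * (q.1 - p.1) = 0 by rewrite mulrBl xx subrr.
have : (s - t) * (q.2 - p.2) = 0 by rewrite mulrBl yy subrr.
move=> /eqP; rewrite mulf_eq0 (negPf st0) subr_eq0 => /eqP p2.
move=> /eqP; rewrite mulf_eq0 (negPf st0) subr_eq0 => /eqP p1.
by rewrite [p]surjective_pairing [q]surjective_pairing p1 p2.
Qed.

Lemma segment_continuous (p q : R * R) : continuous (segment p q).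
Proof.
have affine (a b : R) : continuous (fun s : R => a + s * b).
  move=> s; apply: cvgD; first exact: cvg_cst.
  by apply: cvgM; [exact: cvg_id|exact: cvg_cst].
by move=> s; apply: (cvg_pair (affine _ _ s) (affine _ _ s)).
Qed.

(** Each kind of edge fixes one of x+y, y, x at an integer and puts a coordinate strictly between
    two integers, which reduces incidences to integer arithmetic. *)
Lemma inner_point_step u v P : split_grid_step u v ->
  inner_points (segment (grid_pos u) (grid_pos v)) P ->
  [\/ [/\ path_step u v, P.1 + P.2 = (abscissa u + ordinate u)%:R &
          (ordinate u)%:R < P.2 < (ordinate u).+1%:R],
      [/\ row_step u v, P.2 = (ordinate u)%:R &
          (abscissa u)%:R < P.1 < (abscissa u + 4 * n.+1)%:R] |
      [/\ col_step u v, P.1 = (abscissa u)%:R &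
          (ordinate u)%:R < P.2 < (ordinate u + 4 * n.+1)%:R]].
Proof.
move=> uv [s /=]; rewrite in_itv /= => /andP[s0 s1] <- /=.
have n0 : 0 < (4 * n.+1)%:R :> R by rewrite ltr0n.
have [uh vh] := (height_le u, height_le v).
have sn0 : 0 < s * (4 * n.+1)%:R by rewrite mulr_gt0.
have sn1 : s * (4 * n.+1)%:R < (4 * n.+1)%:R by rewrite gtr_pMl.
case/or3P: uv => step; [apply: Or31|apply: Or32|apply: Or33]; split=> //.
- have [-> ->] : abscissa u = (abscissa v).+1 /\ ordinate v = (ordinate u).+1.
    move: step; rewrite /abscissa /ordinate.
    by move=> /and3P[/eqP-> /eqP-> /eqP]; lia.
  by rewrite natrD -!natr1; lra.
- have -> : ordinate v = (ordinate u).+1.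
    by move: step; rewrite /ordinate => /and3P[/eqP-> _ /eqP->]; rewrite addnS.
  by rewrite -!natr1; lra.
- have -> : ordinate v = ordinate u.
    move: step; rewrite /abscissa /ordinate.
    by move=> /and4P[/eqP-> _ /eqP-> /eqP->].
  by rewrite subrr mulr0 addr0.
- have -> : (abscissa v = abscissa u + 4 * n.+1)%N.
    move: step; rewrite /abscissa /ordinate.
    by move=> /and4P[_ /eqP-> /eqP-> /eqP->]; lia.
  by rewrite !natrD; lra.
- have -> : abscissa v = abscissa u.
    move: step; rewrite /abscissa /ordinate.
    by move=> /and4P[/eqP-> _ /eqP-> /eqP->].
  by rewrite subrr mulr0 addr0.
- have -> : (ordinate v = ordinate u + 4 * n.+1)%N.
    move: step; rewrite /abscissa /ordinate.
    by move=> /and4P[_ /eqP-> /eqP-> /eqP->]; lia.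
  by rewrite !natrD; lra.
Qed.

Lemma inner_point_not_vertex u v w : split_grid_step u v ->
  ~ inner_points (segment (grid_pos u) (grid_pos v)) (grid_pos w).
Proof.
move=> uv /(inner_point_step uv) /=; rewrite -natrD.
have [[uh vh] wh] := (height_le u, height_le v, height_le w).
case=> -[step /eqP]; rewrite eqr_nat !ltr_nat => /eqP e1 /andP[e2 e3].
- by lia.
- move: step e1 e2 e3; rewrite /abscissa /ordinate => /and4P[_ _ /eqP-> _].
  have [->||] := mul_trichotomy n.+1 (grow u) (grow w); try lia.
  by have [->||] := mul_trichotomy n.+1 (gcol u) (gcol w); lia.
- move: step e1 e2 e3; rewrite /abscissa /ordinate => /and4P[_ _ /eqP-> _].
  have [->||] := mul_trichotomy n.+1 (grow u) (grow w); try lia;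
  by have [->||] := mul_trichotomy n.+1 (gcol u) (gcol w); lia.
Qed.

(** Inner points of a path edge have integral x+y but non-integral x and y, while row and column
    edges have one integral coordinate. Among path edges, x+y and the unit interval containing y
    determine the edge. *)
Lemma path_step_uncrossed u v u' v' P :
  path_step u v -> split_grid_step u' v' ->
  inner_points (segment (grid_pos u) (grid_pos v)) P ->
  inner_points (segment (grid_pos u') (grid_pos v')) P -> (u, v) = (u', v').
Proof.
move=> uv uv' /inner_point_step; rewrite /split_grid_step uv => /(_ isT).
case=> -[uvk e1 /andP[e2 e3]]; last 2 first.
- by exfalso; move: uv uvk; rewrite /path_step /row_step; lia.
- have := height_le v; move: uv uvk; rewrite /path_step /col_step; lia.
move=> /(inner_point_step uv')[] [uvk' e1' /andP[e2' e3']].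
- have : ((ordinate u)%:R : R) < (ordinate u').+1%:R by exact: lt_trans e2 e3'.
  have : ((ordinate u')%:R : R) < (ordinate u).+1%:R by exact: lt_trans e2' e3.
  rewrite !ltr_nat => uu' u'u; move/eqP: e1.
  rewrite e1' eqr_nat => /eqP e1; have ordE : ordinate u = ordinate u' by lia.
  have uE : u = u' by apply: grid_pos_nat_inj => //; lia.
  congr pair => //; rewrite -{}uE in uvk'; apply: vertex_eq;
    by move: uv uvk'; rewrite /path_step; lia.
- by move: e2 e3; rewrite e1' !ltr_nat; lia.
have : ((abscissa u' + ordinate u)%:R : R) < (abscissa u + ordinate u)%:R.
  by rewrite -e1 natrD; lra.
have : ((abscissa u + ordinate u)%:R : R) < (abscissa u' + (ordinate u).+1)%:R.
  by rewrite -e1 natrD; lra.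
by rewrite !ltr_nat; lia.
Qed.

(** The equations say that [v] and [v'] are the two ends of one long path; the crossing is the lower
    left corner of its square. *)
Definition row_col_crossing u v u' v' P : Prop :=
  [/\ row_step u v, col_step u' v', gcol u' = (gcol u).+1,
      grow u = (grow u').+1 & P = ((abscissa u')%:R, (ordinate u)%:R)].

(** Two row edges sharing an inner point lie on one row, where they are open intervals of length
    4(n+1) with starts spaced 4(n+1), so they coincide; likewise for columns. *)
Lemma step_crossing u v u' v' P :
  split_grid_step u v -> split_grid_step u' v' ->
  inner_points (segment (grid_pos u) (grid_pos v)) P ->
  inner_points (segment (grid_pos u') (grid_pos v')) P -> (u, v) <> (u', v') ->
  row_col_crossing u v u' v' P \/ row_col_crossing u' v' u v P.
Proof.
move=> uv uv' P_uv P_uv' neq.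
have row_col a b c d : row_step a b -> P.2 = (ordinate a)%:R ->
    (abscissa a)%:R < P.1 < (abscissa a + 4 * n.+1)%:R -> col_step c d ->
    P.1 = (abscissa c)%:R ->
    (ordinate c)%:R < P.2 < (ordinate c + 4 * n.+1)%:R ->
    row_col_crossing a b c d P.
  move=> ab e1 + cd e2; rewrite e1 e2 !ltr_nat => /andP[e3 e4] /andP[e5 e6].
  move: (ab) (cd) => /and4P[_ _ /eqP ha _] /and4P[_ _ /eqP hc _].
  move: e3 e4 e5 e6; rewrite /abscissa /ordinate ha hc => e3 e4 e5 e6.
  split=> //; last by rewrite [P]surjective_pairing e1 e2.
    (* The only multiple of 4(n+1) strictly between 4(n+1)j + 2(n+1) and 4(n+1)j + 6(n+1) is
       4(n+1)(j+1). *)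
    by have [||] := mul_trichotomy n.+1 (gcol c) (gcol a).+1;
      rewrite ?mulnS; lia.
  by have [||] := mul_trichotomy n.+1 (grow a) (grow c).+1;
      rewrite ?mulnS; lia.
have [[uvk e1 e2]|[uvk e1 e2]|[uvk e1 e2]] := inner_point_step uv P_uv.
- by case: neq; apply: path_step_uncrossed uvk uv' P_uv P_uv'.
- have [] := inner_point_step uv' P_uv'; move=> [uvk' e1' e2'].
  + by case: neq; apply/esym; apply: path_step_uncrossed uvk' uv P_uv' P_uv.
  + case: neq; move/eqP: e1; rewrite e1' eqr_nat => /eqP e1.
    move: e2 e2' => /andP[e2 e3] /andP[e2' e3'].
    have := lt_trans e2 e3'; have := lt_trans e2' e3; rewrite !ltr_nat.
    move: (uvk) (uvk') e1 => /and4P[_ _ /eqP hu _] /and4P[_ _ /eqP hu' _].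
    rewrite /abscissa /ordinate hu hu' => e1 e4 e5.
    have [rE||] := mul_trichotomy n.+1 (grow u) (grow u'); try lia.
    have [cE||] := mul_trichotomy n.+1 (gcol u) (gcol u'); try lia.
    congr pair; apply: vertex_eq; move: uvk uvk'; rewrite /row_step; lia.
  + by left; apply: row_col.
have [] := inner_point_step uv' P_uv'; move=> [uvk' e1' e2'].
+ by case: neq; apply/esym; apply: path_step_uncrossed uvk' uv P_uv' P_uv.
+ by right; apply: row_col.
case: neq; move/eqP: e1; rewrite e1' eqr_nat => /eqP e1.
move: e2 e2' => /andP[e2 e3] /andP[e2' e3'].
have := lt_trans e2 e3'; have := lt_trans e2' e3; rewrite !ltr_nat.
move: (uvk) (uvk') e1 => /and4P[_ _ /eqP hu _] /and4P[_ _ /eqP hu' _].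
rewrite /abscissa /ordinate hu hu' => e1 e4 e5.
have [cE||] := mul_trichotomy n.+1 (gcol u) (gcol u'); try lia.
have [rE||] := mul_trichotomy n.+1 (grow u) (grow u'); try lia.
by congr pair; apply: vertex_eq; move: uvk uvk'; rewrite /col_step; lia.
Qed.

Lemma crossing_unique u v u1 v1 u2 v2 P1 P2 :
  row_col_crossing u v u1 v1 P1 \/ row_col_crossing u1 v1 u v P1 ->
  row_col_crossing u v u2 v2 P2 \/ row_col_crossing u2 v2 u v P2 ->
  [/\ u1 = u2, v1 = v2 & P1 = P2].
Proof.
have row_col : row_step u v -> col_step u v -> False.
  by rewrite /row_step /col_step; lia.
case=> -[]; last first.
  move=> row1 col c1 r1 ->; case=> -[]; first by move=> /row_col /(_ col).
  move=> row2 _ c2 r2 ->.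
  have uE : u1 = u2.
    by apply: vertex_eq; move: row1 row2; rewrite /row_step; lia.
  rewrite -uE in row2 *; split=> //.
  by apply: vertex_eq; move: row1 row2; rewrite /row_step; lia.
move=> row col1 c1 r1 ->; case=> -[]; last by move=> _ /(row_col row).
move=> _ col2 c2 r2 ->.
have uE : u1 = u2.
  by apply: vertex_eq; move: col1 col2; rewrite /col_step; lia.
rewrite -uE in col2 *; split=> //.
by apply: vertex_eq; move: col1 col2; rewrite /col_step; lia.
Qed.

Lemma split_grid_one_planar : one_planar R (split_grid n).
Proof.
have neq_pos u v : split_grid_step u v -> grid_pos u <> grid_pos v.
  by move=> uv /grid_pos_inj uE; move: uv; rewrite uE (negPf (step_irr v)).
exists grid_pos, grid_arc; split.
  split.
  - exact: grid_pos_inj.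
  - move=> S /grid_arcP[u [v [_ _ ->]]].
    exact: continuous_subspaceT (@segment_continuous _ _).
  - move=> S /grid_arcP[u [v [uv _ ->]]] s t _ _.
    by move=> /(segment_inj (neq_pos u v uv)).
  - move=> S /grid_arcP[u [v [uv -> ->]]].
    have -> : segment (grid_pos u) (grid_pos v) 0 = grid_pos u.
      by rewrite /segment !mul0r !addr0 -surjective_pairing.
    have -> : segment (grid_pos u) (grid_pos v) 1 = grid_pos v.
      by rewrite /segment !mul1r !subrKC -surjective_pairing.
    apply/seteqP; split=> [P [->|->]|P [w /= + <-]].
    + by exists u; rewrite //= finset.set21.
    + by exists v; rewrite //= finset.set22.
    + by rewrite finset.in_set2 => /orP[/eqP->|/eqP->]; [left|right].
  - move=> S w /grid_arcP[u [v [uv _ ->]]]; exact: inner_point_not_vertex.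
move=> S /grid_arcP[u [v [uv Suv arcS]]] [S1 P1] [S2 P2] [/=].
move=> /grid_arcP[u1 [v1 [uv1 S1E ->]]] S1S; rewrite arcS => P1S P1S1 [/=].
move=> /grid_arcP[u2 [v2 [uv2 S2E ->]]] S2S; rewrite arcS => P2S P2S2.
have neq1 : (u, v) <> (u1, v1)
  by case=> uE vE; apply: S1S; rewrite S1E Suv uE vE.
have neq2 : (u, v) <> (u2, v2)
  by case=> uE vE; apply: S2S; rewrite S2E Suv uE vE.
have [uE vE ->] := crossing_unique (step_crossing uv uv1 P1S P1S1 neq1)
  (step_crossing uv uv2 P2S P2S2 neq2).
by rewrite S1E S2E uE vE.
Qed.
End Drawing.

Theorem corollary9 (R : realType) :
  ~ admits_geodesic_structure (@one_planar R).
Proof.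
move=> [c cP].
(* With n = 16(c+1) the bound n+1 <= 16(c+1) fails. *)
have twc := cP _ (split_grid_one_planar R (16 * c.+1)).
have := geodesic_treewidth_split_grid twc.
by rewrite ltnn.
Qed.
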